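(* Let $E$ be a finite nonempty set and $u:2^E\to\mathbb{R}$ ordinally concave. Then for every $X,Y\in 2^E$ and every $U\in\mathbf{C}_u(X\cup Y,E)$ there exists $Z\in\mathbf{C}_u(X,E)$ such that $U\setminus(X\cup Y)\subseteq Z\setminus(X\cup Y)$.
   Context: Notation: for $X\subseteq E$ and $x\in E\setminus X$, $X+x=X\cup\{x\}$; for $x\in X$, $X-x=X\setminus\{x\}$. The symbol $\emptyset$ is also used as a formal element not in $E$, with $X+\emptyset=X-\emptyset=X$. A function $u:2^E\to\mathbb{R}$ is ordinally concave if for every $X,X'\in 2^E$ and every $x\in X\setminus X'$ there exists $x'\in(X'\setminus X)\cup\{\emptyset\}$ such that (i) $u(X)<u(X-x+x')$, or (ii) $u(X')<u(X'-x'+x)$, or (iii) $u(X)=u(X-x+x')$ and $u(X')=u(X'-x'+x)$. For $A\subseteq B\subseteq E$, $\mathbf{C}_u(A,B)=\operatorname{Arg}\max\{u(Z)\mid A\subseteq Z\subseteq B\}$. *)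

(* Defs.v *)
From HB Require Import structures.
From mathcomp Require Import all_boot all_order all_algebra.
From mathcomp Require Import reals.

Set Implicit Arguments.
Unset Strict Implicit.
Unset Printing Implicit Defensive.

Import Order.TTheory GRing.Theory Num.Theory.
Local Open Scope ring_scope.

(* The formal element written as the empty set in the source is None, and
   x : E is Some x; adding or removing None leaves the set unchanged. *)
Definition oadd (E : finType) (X : {set E}) (o : option E) : {set E} :=
  if o is Some x then x |: X else X.

Definition orem (E : finType) (X : {set E}) (o : option E) : {set E} :=
  if o is Some x then X :\ x else X.

Definition oin (E : finType) (o : option E) (X : {set E}) : bool :=
  if o is Some x then x \in X else true.

Definition ordinally_concave (R : realType) (E : finType)
    (u : {set E} -> R) : Prop :=
  forall (X X' : {set E}) (x : E), x \in X :\: X' ->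
  exists x' : option E,
    oin x' (X' :\: X) /\
    [\/ u X < u (oadd (X :\ x) x'),
        u X' < u (x |: orem X' x')
      | u X = u (oadd (X :\ x) x') /\ u X' = u (x |: orem X' x')].

Definition argmax_between (R : realType) (E : finType) (u : {set E} -> R)
    (A B : {set E}) : {set {set E}} :=
  [set Z : {set E} | [&& A \subset Z, Z \subset B &
     [forall W : {set E}, (A \subset W) && (W \subset B) ==> (u W <= u Z)]]].

(* Main.v *)
Require Import Defs.
From HB Require Import structures.
From mathcomp Require Import all_boot all_order all_algebra.
From mathcomp Require Import reals.

Set Implicit Arguments.
Unset Strict Implicit.
Unset Printing Implicit Defensive.

Import Order.TTheory.

(** Among the maximisers [Z] of [u] above [X], take one that contains as many
    elements of [U :\: (X :|: Y)] as possible.  If it misses some [x], exchange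
    [x] between [U] and [Z]: both exchanged sets remain feasible, so neither
    value can strictly increase, and ordinal concavity makes the exchanged [Z]
    another maximiser, which contains one more element of [U :\: (X :|: Y)]. *)

Lemma argmax_aboveP (R : realType) (E : finType) (u : {set E} -> R)
    (A Z : {set E}) :
  reflect (A \subset Z /\ forall W : {set E}, A \subset W -> (u W <= u Z)%R)
          (Z \in argmax_between u A [set: E]).
Proof.
rewrite inE subsetT /=; apply: (iffP andP) => -[AZ maxZ]; split=> //.
  by move=> W AW; move/forallP/(_ W): maxZ; rewrite AW subsetT.
by apply/forallP => W; apply/implyP => /andP[AW _]; apply: maxZ.
Qed.

Lemma argmax_above_exists (R : realType) (E : finType) (u : {set E} -> R)
    (A : {set E}) :
  exists Z : {set E}, Z \in argmax_between u A [set: E].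
Proof.
case: (@arg_maxP _ R _ [set: E] (fun Z : {set E} => A \subset Z) u).
  exact: subsetT.
by move=> Z AZ maxZ; exists Z; apply/argmax_aboveP; split=> // W; apply: maxZ.
Qed.

(** Concavity is applied with [x] leaving [U] and entering [Z]. Whatever leaves [Z] in return lies
    outside [U], so all of [Z :&: U] survives. *)
Lemma argmax_above_exchange (R : realType) (E : finType) (u : {set E} -> R)
    (A B U Z : {set E}) (x : E) :
    ordinally_concave u -> A \subset B ->
    U \in argmax_between u B [set: E] -> Z \in argmax_between u A [set: E] ->
    x \in U -> x \notin B -> x \notin Z ->
  exists2 Z' : {set E}, Z' \in argmax_between u A [set: E] &
    x |: (Z :&: U) \subset Z'.
Proof.
move=> uc AB /argmax_aboveP[BU maxU] /argmax_aboveP[AZ maxZ] xU xB xZ.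
have [|z [zin]] := uc U Z x; first by rewrite inE xU xZ.
(* Feasible for [U]: the only element removed, [x], is not in [B]. *)
have BUz : B \subset oadd (U :\ x) z.
  have BUx : B \subset U :\ x by rewrite subsetD1 BU xB.
  by case: z {zin} => [z|] //=; apply: subset_trans BUx (subsetUr _ _).
have ZUz : x |: (Z :&: U) \subset x |: orem Z z.
  apply: setUS; case: z {BUz} zin => [z|] /=; last by rewrite subsetIl.
  by rewrite inE subsetD1 subsetIl inE => /andP[/negPf-> _]; rewrite andbF.
(* Feasible for [Z]: [A] lies in both [Z] and [B], hence in [Z :&: U], which is kept. *)
have AZz : A \subset x |: orem Z z.
  apply: subset_trans ZUz; apply: subset_trans (subsetUr _ _).
  by rewrite subsetI AZ (subset_trans AB BU).
case=> [ltU|ltZ|[_ eqZ]].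
- by have := maxU _ BUz; rewrite leNgt ltU.
- by have := maxZ _ AZz; rewrite leNgt ltZ.
- by exists (x |: orem Z z) => //; apply/argmax_aboveP; rewrite -eqZ.
Qed.

Theorem theorem4p4 (R : realType) (E : finType) (E_nonempty : 0 < #|E|)
    (u : {set E} -> R) (u_concave : ordinally_concave u)
    (X Y U : {set E}) (UC : U \in argmax_between u (X :|: Y) [set: E]) :
  exists2 Z : {set E}, Z \in argmax_between u X [set: E] &
    U :\: (X :|: Y) \subset Z :\: (X :|: Y).
Proof.
have [Z0 Z0C] := argmax_above_exists u X.
pose D := U :\: (X :|: Y).
(* [Z0] only witnesses that there is a maximiser to choose from. *)
case: (@arg_maxnP _ Z0 (fun Z => Z \in argmax_between u X [set: E])
  (fun Z => #|Z :&: D|) Z0C) => Z ZC maxZ.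
exists Z => //; apply/subsetP => x xD; have := xD.
rewrite !in_setD => /andP[xXY xU]; rewrite xXY /=; apply: contraT => xZ.
have [Z' Z'C sZ'] :=
  argmax_above_exchange u_concave (subsetUl X Y) UC ZC xU xXY xZ.
have := maxZ _ Z'C; rewrite /= leqNgt => /negP[].
(* Since [D] is part of [U], [Z :&: D] is kept in [Z']; the new element [x] makes the inclusion
   strict. *)
apply: proper_card; apply/properP; split.
  rewrite subsetI subsetIr andbT; apply: subset_trans sZ'.
  by apply: subset_trans (subsetUr _ _); apply: setIS; apply: subsetDl.
exists x; last by rewrite inE (negPf xZ).
by rewrite inE xD (subsetP sZ') ?setU11.
Qed.
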